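(* Let $k\geq 3$ and let $\Delta_k$ be the marked group $\mathbb{Z}/k\mathbb{Z}\rtimes_{\varphi_k}\mathbb{Z}$, where $\varphi_k:\mathbb{Z}\to\mathrm{Aut}(\mathbb{Z}/k\mathbb{Z})$ sends $1$ to the inversion map (so the product is $(a,m)(b,n)=(a+(-1)^m b,m+n)$), with generating set consisting of the elements $(i,0)$ for $i\neq 0$, $(i,1)$ for $i\notin\{0,1\}$, and $(i,-1)$ for $i\notin\{0,1\}$ (where $i$ ranges over $\mathbb{Z}/k\mathbb{Z}$). Then $\chi_B(F(2^{\Delta_k}))=k+1$.
   Context: A marked group is a finitely generated group $\Gamma$ with a finite symmetric generating set $S$ not containing the identity. The left shift action of $\Gamma$ on $2^\Gamma$ is $(g\cdot x)(h)=x(g^{-1}h)$; its free part is $F(2^\Gamma)=\{x\in 2^\Gamma : g\cdot x\neq x \text{ for all } g\neq \mathrm{id}\}$. The shift graph $F(2^\Gamma)$ is the graph on this free part joining distinct $x,y$ iff $s\cdot x=y$ for some $s\in S$. $\chi_B(G)$ denotes the Borel chromatic number: the least $k$ such that there is a Borel map $c$ from the vertex set to a $k$-element set with $c(x)\neq c(y)$ for adjacent $x,y$. *)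

(* Defs.v *)
From HB Require Import structures.
From mathcomp Require Import all_boot all_order all_algebra.
From mathcomp Require Import all_classical all_reals all_analysis.

Set Implicit Arguments.
Unset Strict Implicit.
Unset Printing Implicit Defensive.

Import GRing.Theory.

Local Open Scope classical_set_scope.

Record is_marking (G : groupType) (S : set G) : Prop := IsMarking {
  marking_finite : finite_set S;
  marking_symmetric : forall s : G, S s -> S s^-1%g;
  marking_not1 : ~ S 1%g;
  marking_generates : forall H : set G,
    H 1%g -> (forall g h : G, H g -> H h -> H (g * h)%g) ->
    (forall g : G, H g -> H g^-1%g) -> S `<=` H -> H = setT
}.

(* 2^G with the product topology, the topology on bool being discrete. *)
Definition shift_space (G : groupType) : topologicalType :=
  prod_topology (fun _ : G => bool).

Definition shift_act (G : groupType) (g : G) (x : shift_space G) :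
    shift_space G :=
  fun h : G => x (g^-1 * h)%g.

Definition free_part (G : groupType) : set (shift_space G) :=
  [set x | forall g : G, g <> 1%g -> shift_act g x <> x].

(* The vertices are the elements of the set_type of free_part G, whose
   canonical topology is the subspace topology inherited from 2^G. *)
Definition shift_graph (G : groupType) (S : set G)
    (x y : set_type (@free_part G)) : Prop :=
  x <> y /\ exists2 s : G, S s & shift_act s (set_val x) = set_val y.

Definition borel_set (T : topologicalType) : set (set T) :=
  <<s [set U : set T | open U] >>.

(* All subsets of the finite set of colours 'I_n are Borel. *)
Definition borel_colorable (T : topologicalType) (E : T -> T -> Prop)
    (n : nat) : Prop :=
  exists c : T -> 'I_n,
    (forall B : set 'I_n, borel_set (c @^-1` B)) /\
    (forall x y : T, E x y -> c x <> c y).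

Definition is_borel_chromatic_number (T : topologicalType)
    (E : T -> T -> Prop) (n : nat) : Prop :=
  borel_colorable E n /\ forall m : nat, borel_colorable E m -> (n <= m)%N.

(* Carrier of the semidirect product of Z/k by Z. For k < 2 the type 'Z_k is
   Z/2, so Delta k is the intended group only when k >= 2. *)
Definition Delta (k : nat) : Type := ('Z_k * int)%type.

HB.instance Definition _ (k : nat) := Choice.on (Delta k).

Section DeltaGroup.
Variable k : nat.
Local Open Scope ring_scope.
Implicit Types x y z : Delta k.

Definition Delta_one : Delta k := (0, 0).

Definition Delta_mul x y : Delta k := (x.1 + (-1) ^ x.2 * y.1, x.2 + y.2).

Definition Delta_inv x : Delta k := (- ((-1) ^ (- x.2) * x.1), - x.2).

Let m1unit : (-1 : 'Z_k) \is a GRing.unit.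
Proof. by rewrite unitrN unitr1. Qed.

Fact Delta_mulA : associative Delta_mul.
Proof.
move=> x y z; rewrite /Delta_mul /=; congr pair; last by rewrite addrA.
by rewrite mulrDr addrA exprzDr // mulrA.
Qed.

Fact Delta_mul1 : left_id Delta_one Delta_mul.
Proof. by case=> a m; rewrite /Delta_mul /= expr0z mul1r !add0r. Qed.

Fact Delta_mulr1 : right_id Delta_one Delta_mul.
Proof. by case=> a m; rewrite /Delta_mul /= mulr0 !addr0. Qed.

Fact Delta_mulV : left_inverse Delta_one Delta_inv Delta_mul.
Proof. by case=> a m; rewrite /Delta_mul /Delta_inv /= !addNr. Qed.

Fact Delta_mulrV : right_inverse Delta_one Delta_inv Delta_mul.
Proof.
case=> a m; rewrite /Delta_mul /Delta_inv /= mulrN mulrA -exprzDr //.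
by rewrite !subrr expr0z mul1r subrr.
Qed.

HB.instance Definition _ := isGroup.Build (Delta k)
  Delta_mulA Delta_mul1 Delta_mulr1 Delta_mulV Delta_mulrV.

Definition Delta_gens : set (Delta k) :=
  [set x : Delta k | [\/ x.1 <> 0 /\ x.2 = 0,
                         [/\ x.1 <> 0, x.1 <> 1 & x.2 = 1]
                       | [/\ x.1 <> 0, x.1 <> 1 & x.2 = -1]]].

End DeltaGroup.

Section DeltaMarking.
Variable k : nat.
Hypothesis k_ge3 : (3 <= k)%N.
Local Open Scope ring_scope.

Lemma Delta_marking : is_marking (@Delta_gens k).
Proof.
split.
- pose l : seq (Delta k) :=
    [seq ((i, z) : 'Z_k * int) | i <- enum 'Z_k, z <- [:: 0; 1; -1]].
  apply: (@sub_finite_set _ _ [set` l]); last exact: finite_seq.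
  move=> [i z] /= h; apply/allpairsP; exists (i, z) => /=.
  rewrite mem_enum; split=> //.
  by case: h => /= [[_ ->]|[_ _ ->]|[_ _ ->]]; rewrite !inE eqxx ?orbT.
- move=> [i z]; change (Delta_gens ((i, z) : Delta k) ->
    Delta_gens (Delta_inv ((i, z) : Delta k))).
  rewrite /Delta_gens /Delta_inv /=; case=> [[i0 ->]|[i0 i1 ->]|[i0 i1 ->]].
  + constructor 1; rewrite oppr0 expr0z mul1r; split=> // /eqP.
    by rewrite oppr_eq0 => /eqP.
  + by constructor 3; rewrite exprN1 invrN1 mulN1r opprK.
  + by constructor 2; rewrite opprK expr1z mulN1r opprK.
- rewrite /Delta_gens /= => -[[]|[]|[]]; by [].
- move=> H H1 HM HV HS.
  have {}HM (x y : Delta k) : H x -> H y -> H (Delta_mul x y) by exact: HM.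
  have {}HV (x : Delta k) : H x -> H (Delta_inv x) by exact: HV.
  apply/seteqP; split=> // -[i z] _.
  have Hi (j : 'Z_k) : H ((j, 0) : Delta k).
    have [->|/eqP j0] := eqVneq j 0; first exact: H1.
    by apply: HS; constructor 1.
  have Hm1 : H ((-1, 1) : Delta k).
    apply: HS; constructor 2; split=> //=.
      by apply/eqP; rewrite oppr_eq0 oner_neq0.
    move=> /eqP; rewrite -subr_eq0 -opprD oppr_eq0 => /eqP/(congr1 val).
    by case: k k_ge3 => [|[|[|k']]].
  have Hj (j : 'Z_k) : H ((j, 1) : Delta k).
    suff -> : (j, 1) = Delta_mul (j + 1, 0) (-1, 1) by exact: HM.
    by rewrite /Delta_mul /= expr0z mul1r addrK add0r.
  have Hn (n : nat) : H ((0, n%:Z) : Delta k).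
    elim: n => [|n IH]; first exact: H1.
    suff -> : (0, n.+1%:Z) = Delta_mul ((0, n%:Z) : Delta k) (0, 1).
      exact: HM.
    by rewrite /Delta_mul /= mulr0 addr0 -PoszD addn1.
  have Hz (w : int) : H ((0, w) : Delta k).
    case: w => n; first exact: Hn.
    by have /HV := Hn n.+1; rewrite /Delta_inv /= mulr0 oppr0 NegzE.
  suff -> : (i, z) = Delta_mul (i, 0) (0, z) by exact: HM.
  by rewrite /Delta_mul /= mulr0 addr0 add0r.
Qed.

End DeltaMarking.

(* Main.v *)
Require Import Defs.
From mathcomp Require Import all_boot all_order all_algebra all_fingroup.
From mathcomp Require Import all_classical all_reals all_analysis.
From mathcomp Require Import finmap zify ring.

(** The layer [{(a, m) | a in Z/k}] is a [k]-clique, and [(a, m)] is joined to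
    every [(b, m + 1)] except [b = - a] and [b = 1 - a].

    Lower bound. A [k]-coloring is a bijection on each layer, and two
    consecutive layers carry the same colors up to a reflection
    [a |-> d - a] with [d] constant.  Color classes have the Baire property,
    hence are open along the orbit of a generic point, and a generic point
    returns arbitrarily close to itself after an odd number of steps.  Some odd
    layer is thus colored like layer [0], but a product of an odd number of
    reflections of [Z/k] is a reflection, which is not the identity.

    Upper bound. With one spare color, a layer may be recolored one vertex at
    a time, following the lines [(a, m), (- a, m + 1), ...].  These moves are
    the transpositions with a fixed point (the unused color), so they connect
    any two colorings of a layer in every sufficiently large number of steps.
    A Borel maximal set of sparse markers fixes the coloring on the layers it
    meets, and the gaps are filled by such walks. *)

Set Implicit Arguments.
Unset Strict Implicit.
Unset Printing Implicit Defensive.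

Local Open Scope classical_set_scope.

(** * Borel sets *)

Section BorelSets.
Variable T : topologicalType.
Implicit Types A B : set T.

Lemma open_borel A : open A -> borel_set A.
Proof. exact: sub_sigma_algebra. Qed.

Lemma borel_set0 : borel_set (@set0 T).
Proof. exact: sigma_algebra0. Qed.

Lemma borel_setC A : borel_set A -> borel_set (~` A).
Proof. by move=> /(@sigma_algebraCD _ setT); rewrite setTD. Qed.

Lemma borel_bigcup I (D : set I) (F : I -> set T) :
  countable D -> (forall i, D i -> borel_set (F i)) ->
  borel_set (\bigcup_(i in D) F i).
Proof.
move=> /pfcard_geP[-> _|[f] FB].
  by rewrite bigcup_set0; exact: borel_set0.
rewrite -(image_eq f) bigcup_image; apply: sigma_algebra_bigcup => n.
by apply: FB; exact: funS.
Qed.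

Lemma borel_bigcap I (D : set I) (F : I -> set T) :
  countable D -> (forall i, D i -> borel_set (F i)) ->
  borel_set (\bigcap_(i in D) F i).
Proof.
move=> cD FB; rewrite -[X in borel_set X]setCK setC_bigcap.
apply: borel_setC; apply: borel_bigcup => // i Di.
by apply: borel_setC; exact: FB.
Qed.

Lemma borel_setU A B : borel_set A -> borel_set B -> borel_set (A `|` B).
Proof.
move=> bA bB; rewrite -bigcup2E; apply: borel_bigcup => [|[|[|n]] _] //.
exact: borel_set0.
Qed.

Lemma borel_setI A B : borel_set A -> borel_set B -> borel_set (A `&` B).
Proof.
move=> bA bB; rewrite -[_ `&` _]setCK setCI.
by apply: borel_setC; apply: borel_setU; exact: borel_setC.
Qed.

End BorelSets.

Lemma borel_preimage (T U : topologicalType) (f : T -> U) (B : set U) :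
  continuous f -> borel_set B -> borel_set (f @^-1` B).
Proof.
move=> /continuousP cf bB; rewrite -[f @^-1` B]setTI.
suff : image_set_system setT f (@borel_set T) B by [].
move: B bB; apply: smallest_sub => [|B oB].
  exact/sigma_algebra_image/smallest_sigma_algebra.
by rewrite /image_set_system /= setTI; apply: open_borel; exact: cf.
Qed.

Lemma borel_set_type (T : topologicalType) (A : set T) (B : set (set_type A)) :
  borel_set B -> exists2 C, borel_set C & B = set_val @^-1` C.
Proof.
move=> bB.
have [C bC <-] : preimage_set_system setT (@set_val _ A) (@borel_set T) B.
  move: B bB; apply: smallest_sub.
    exact/sigma_algebra_preimage/smallest_sigma_algebra.
  by move=> B [U oU <-]; exists U; [exact: open_borel|rewrite setTI].
by exists C => //; rewrite setTI.
Qed.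

Definition proper_coloring (T C : Type) (E : T -> T -> Prop) (c : T -> C) :=
  forall x y, E x y -> c x <> c y.

Lemma borel_colorable_finType (T : topologicalType) (E : T -> T -> Prop)
    (C : finType) (c : T -> C) (n : nat) :
  (forall i, borel_set (c @^-1` [set i])) ->
  proper_coloring E c -> (#|C| <= n)%N -> borel_colorable E n.
Proof.
move=> bc pc Cn; pose rank i := widen_ord Cn (enum_rank i).
exists (rank \o c); split=> [B|x y /pc cxy]; last first.
  by move=> /(congr1 val) /= /val_inj/enum_rank_inj.
rewrite (_ : _ @^-1` B = \bigcup_(i in rank @^-1` B) c @^-1` [set i]).
  by apply: borel_bigcup => // i _; exact: bc.
by apply/seteqP; split=> [x Bx|x [i Bi /= ->]] //; exists (c x).
Qed.

(** * Baire category *)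

Section Residual.
Variable T : topologicalType.
Implicit Types P Q U : set T.

Definition residual P := exists2 F : set (set T),
  countable F /\ (forall U, F U -> open U /\ dense U) &
  \bigcap_(U in F) U `<=` P.

Lemma residualS P Q : P `<=` Q -> residual P -> residual Q.
Proof. by move=> PQ [F FP sFP]; exists F => //; exact: subset_trans PQ. Qed.

Lemma residual_open_dense U : open U -> dense U -> residual U.
Proof.
move=> oU dU; exists [set U]; last by rewrite bigcap_set1.
by split=> [|_ ->]; first exact: countable1.
Qed.

Lemma residualT : residual setT.
Proof. by exists set0; first by split=> //; exact: countable0. Qed.

Lemma residual_bigcap I (D : set I) (P : I -> set T) : countable D ->
  (forall i, D i -> residual (P i)) -> residual (\bigcap_(i in D) P i).
Proof.
move=> cD rP; have /choice[F FP] : forall i, exists F : set (set T), D i ->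
    [/\ countable F, forall U, F U -> open U /\ dense U &
        \bigcap_(U in F) U `<=` P i].
  move=> i; have [Di|nDi] := pselect (D i); last by exists set0.
  by have [F [cF oF] FPi] := rP i Di; exists F.
exists (\bigcup_(i in D) F i).
  split; first by apply: bigcup_countable => // i /FP[].
  by move=> U [i /FP[_ + _]]; exact.
by move=> x Fx i Di; have [_ _] := FP i Di; apply=> U FU; apply: Fx; exists i.
Qed.

Lemma residualI P Q : residual P -> residual Q -> residual (P `&` Q).
Proof.
move=> rP rQ; rewrite -bigcap2E; apply: residual_bigcap => [|[|[|n]] _] //.
exact: residualT.
Qed.

End Residual.

Lemma dense_preimage (T U : topologicalType) (f : T -> U) (A : set U) :
  (forall V, open V -> open (f @` V)) -> dense A -> dense (f @^-1` A).
Proof.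
move=> f_open dA V [x Vx] oV.
have [|_ [[y Vy <-] Ay]] := dA (f @` V) _ (f_open V oV).
  by exists (f x), x.
by exists y.
Qed.

Lemma residual_preimage (T U : topologicalType) (f : T -> U) (P : set U) :
  continuous f -> (forall V, open V -> open (f @` V)) ->
  residual P -> residual (f @^-1` P).
Proof.
move=> /continuousP cf f_open [F [cF oF] FP]; exists [set f @^-1` V | V in F].
  split; first exact: sub_countable (card_image_le _ _) cF.
  by move=> _ [V /oF[oV dV] <-]; split; [exact: cf|exact: dense_preimage].
by move=> x Fx; apply: FP => V FV; apply: (Fx (f @^-1` V)); exists V.
Qed.

Section CompactHausdorffBaire.
Variable T : topologicalType.
Hypotheses (cT : compact [set: T]) (hT : hausdorff_space T).

Lemma compact_hausdorff_shrink (V : set T) : open V -> V !=set0 ->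
  exists W, [/\ open W, W !=set0 & closure W `<=` V].
Proof.
move=> oV [x Vx].
have [|B xB BV] := @compact_regular _ x setT hT cT filterT V.
  exact: open_nbhs_nbhs.
exists B°; split; [exact: open_interior|by exists x|].
by apply: subset_trans BV; apply: closure_subset; exact: interior_subset.
Qed.

Lemma nested_closure_nonempty (V : nat -> set T) : (forall n, V n !=set0) ->
  (forall n, V n.+1 `<=` V n) -> \bigcap_n closure (V n) !=set0.
Proof.
move=> V0 VS; have Vle m n : (m <= n)%N -> V n `<=` V m.
  apply: (@homo_leq _ V (fun A B => B `<=` A)) => [A|B A C BA CB|//].
    exact: subset_refl.
  exact: subset_trans CB BA.
have FV : ProperFilter (filter_from setT V).
  apply: filter_from_proper => //.
  apply: filter_from_filter; first by exists 0%N.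
  move=> m n _ _; exists (maxn m n) => //; rewrite subsetI.
  by split; apply: Vle; rewrite ?leq_maxl ?leq_maxr.
have [|p [_ pV]] := @cT _ FV; first exact: filterT.
by exists p => n _ U pU; apply: pV pU; exists n.
Qed.

Theorem compact_hausdorff_baire (D : nat -> set T) :
  (forall n, open (D n) /\ dense (D n)) -> dense (\bigcap_n D n).
Proof.
move=> oD O O0 oO; have /choice[next nextP] : forall p : nat * set T,
    exists W, open p.2 -> p.2 !=set0 ->
    [/\ open W, W !=set0 & closure W `<=` p.2 `&` D p.1].
  move=> [n V]; have [[oV V0]|nV] := pselect (open V /\ V !=set0); last first.
    by exists set0 => /= oV V0; case: nV.
  have [oDn dDn] := oD n.
  have [W WP] := compact_hausdorff_shrink (openI oV oDn) (dDn V V0 oV).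
  by exists W.
pose V := fix V n := if n is m.+1 then next (m, V m) else O.
have VP n : open (V n) /\ V n !=set0.
  by elim: n => // n [oV V0]; have [] := nextP (n, V n) oV V0.
have clV n : closure (V n.+1) `<=` V n `&` D n.
  by have [oV V0] := VP n; have [] := nextP (n, V n) oV V0.
have [p Vp] : \bigcap_n closure (V n) !=set0.
  apply: nested_closure_nonempty => n; first by have [] := VP n.
  by move=> x /subset_closure/clV[].
exists p; split; first by have [] := clV 0%N p (Vp 1%N I).
by move=> n _; have [] := clV n p (Vp n.+1 I).
Qed.

Corollary residual_dense (P : set T) : residual P -> dense P.
Proof.
move=> [F [/pfcard_geP F0f oF] FP] O O0 oO; case: F0f => [F0|[f]].
  by case: O0 => x Ox; exists x; split=> //; apply: FP; rewrite F0 bigcap_set0.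
have [|x [Ox fx]] := @compact_hausdorff_baire f _ O O0 oO.
  by move=> n; apply: oF; exact: funS.
exists x; split=> //; apply: FP; rewrite -(image_eq f) bigcap_image.
exact: fx.
Qed.

End CompactHausdorffBaire.

Lemma dense_setU_interiorC (T : topologicalType) (U V : set T) :
  (forall O, open O -> O `&` U !=set0 -> O `&` V !=set0) ->
  dense (V `|` (~` U)°).
Proof.
move=> UV O [x Ox] oO.
have [/(UV O oO)[y [Oy Vy]]|OU0] := pselect (O `&` U !=set0).
  by exists y; split=> //; left.
exists x; split=> //; right; apply: (filterS _ (open_nbhs_nbhs (conj oO Ox))).
by move=> y Oy Uy; apply: OU0; exists y.
Qed.

Section BaireProperty.
Variable T : topologicalType.
Implicit Types A U : set T.

Definition baire_property A :=
  exists2 U, open U & residual [set x | A x <-> U x].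

Lemma baire_property_setC A : baire_property A -> baire_property (~` A).
Proof.
move=> [U oU AU]; exists (~` U)°; first exact: open_interior.
have := residual_open_dense (openU oU (@open_interior _ _))
  (@dense_setU_interiorC _ U U (fun=> fun=> id)).
move=> /(residualI AU); apply: residualS => x [/= AUx [Ux|UCx]].
  by split=> [/(_ (AUx.2 Ux))//|/interior_subset].
by split=> // _ /AUx; exact: interior_subset UCx.
Qed.

Lemma baire_property_bigcup (A : nat -> set T) :
  (forall n, baire_property (A n)) -> baire_property (\bigcup_n A n).
Proof.
move=> rA; have /choice[U UP] : forall n, exists U, open U /\
    residual [set x | A n x <-> U x] by move=> n; have [U] := rA n; exists U.
exists (\bigcup_n U n); first by apply: bigcup_open => n _; exact: (UP n).1.
have /residual_bigcap := fun n (_ : setT n) => (UP n).2.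
move=> /(_ (countableP _)); apply: residualS => x AUx.
by split=> -[n _ /(AUx n I)]; exists n.
Qed.

Theorem borel_baire_property A : borel_set A -> baire_property A.
Proof.
move: A; apply: smallest_sub => [|A oA]; last first.
  by exists A => //; apply: residualS (@residualT T) => x _.
split=> [|A|]; last exact: baire_property_bigcup.
- by exists set0; [exact: open0|apply: residualS (@residualT T) => x _].
- by rewrite setTD; exact: baire_property_setC.
Qed.

End BaireProperty.

Lemma residual_recurrent (T : topologicalType) I (Q : set I) (f : I -> T -> T) :
  @second_countable T -> (forall i, continuous (f i)) ->
  (forall U, open U -> U !=set0 -> exists2 i, Q i & U `&` f i @^-1` U !=set0) ->
  residual [set x | forall U, nbhs x U -> exists2 i, Q i & U (f i x)].
Proof.
move=> [B cB [oB nB]] cf Q_returns.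
have : residual (\bigcap_(b in B) [set x | b x -> exists2 i, Q i & b (f i x)]).
  apply: residual_bigcap => // b Bb.
  apply: (@residualS _ (\bigcup_(i in Q) f i @^-1` b `|` (~` b)°)).
    by move=> x [[i Qi bfx] _|/interior_subset nbx /nbx//]; exists i.
  apply: residual_open_dense.
    apply: openU; last exact: open_interior.
    apply: bigcup_open => i _; have /continuousP := cf i.
    by apply; exact: oB.
  apply: dense_setU_interiorC => O oO Ob0.
  have [i Qi [y [[Oy _] [_ bfy]]]] := Q_returns _ (openI oO (oB _ Bb)) Ob0.
  by exists y; split=> //; exists i.
apply: residualS => x recx U /nB[b [Bb bx] bU].
by have [i Qi /bU] := recx b Bb bx; exists i.
Qed.

(** * Borel maximal independent sets *)

Section MaximalIndependentSet.
Variables (T : topologicalType) (I : choiceType) (W : set I) (f : I -> T -> T).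
Hypotheses (finW : finite_set W) (cf : forall i, continuous (f i)).
Hypothesis f_sym : forall i x, W i -> exists2 j, W j & f j (f i x) = x.

Definition independent (A : set T) := forall i x, W i -> A x -> ~ A (f i x).

Section Greedy.
Variable V : nat -> set T.
Hypotheses (bV : forall n, borel_set (V n)) (iV : forall n, independent (V n)).

Fixpoint greedy n : set T := if n is m.+1
  then greedy m `|` (V m `\` \bigcup_(i in W) f i @^-1` greedy m) else set0.

Lemma greedy_borel n : borel_set (greedy n).
Proof.
elim: n => [|n IH]; first exact: borel_set0.
apply: borel_setU => //; apply: borel_setI => //; apply: borel_setC.
apply: borel_bigcup => [|i _]; first exact: finite_set_countable.
exact: borel_preimage.
Qed.

Lemma greedy_monotone m n : (m <= n)%N -> greedy m `<=` greedy n.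
Proof.
apply: (@homo_leq _ greedy subset) => [A|B A C|i]; first exact: subset_refl.
  exact: subset_trans.
exact: subsetUl.
Qed.

Lemma greedy_independent n : independent (greedy n).
Proof.
elim: n => [|n IH] i x Wi //= [xn|[Vx nx]] [yn|[Vy ny]].
- exact: IH xn yn.
- have [j Wj fji] := f_sym x Wi; apply: ny; exists j => //.
  by rewrite /= fji.
- by apply: nx; exists i.
- exact: iV Vx Vy.
Qed.

Lemma greedy_maximal n x : V n x ->
  greedy n.+1 x \/ exists2 i, W i & greedy n (f i x).
Proof.
by move=> Vx; have [|nW] := pselect (exists2 i, W i & greedy n (f i x));
  [right|left; right].
Qed.

End Greedy.

Hypotheses (scT : @second_countable T) (hT : hausdorff_space T).
Hypothesis f_fixed_point_free : forall i x, W i -> f i x <> x.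

Lemma independent_nbhs (x : T) : exists2 U, nbhs x U & independent U.
Proof.
have sep i : exists U, W i -> nbhs x U /\ forall y, U y -> ~ U (f i y).
  have [Wi|nWi] := pselect (W i); last by exists setT.
  have /eqP fx := f_fixed_point_free (x := x) Wi.
  move: hT; rewrite open_hausdorff => /(_ _ _ fx)[[A B] /=].
  move=> [/set_mem xA /set_mem yB] [oA oB /eqP AB0].
  exists (B `&` f i @^-1` A) => _; split.
    apply: filterI; first exact: open_nbhs_nbhs.
    by apply: cf; exact: open_nbhs_nbhs.
  by move=> y [_ Ay] [By _]; rewrite -[False]/(set0 (f i y)) -AB0.
have /choice[U UP] := sep; exists (\bigcap_(i in [set` fset_set W]) U i).
  by apply: filter_bigI => i; rewrite in_fset_set // => /set_mem/UP[].
move=> i y Wi Uy Ufy.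
have iW : i \in fset_set W by rewrite in_fset_set // mem_set.
exact: (UP i Wi).2 (Uy i iW) (Ufy i iW).
Qed.

Lemma independent_open_cover : exists V : nat -> set T,
  [/\ forall n, open (V n), forall n, independent (V n) &
      forall x, exists n, V n x].
Proof.
have [B cB [oB nB]] := scT.
have cover x : exists2 U, B U /\ independent U & U x.
  have [U /nB[b [Bb bx] bU] iU] := independent_nbhs x.
  by exists b => //; split=> // i y Wi /bU yU /bU; exact: iU yU.
have : countable [set U | B U /\ independent U].
  by apply: sub_countable cB; apply: subset_card_le => U [].
move=> /pfcard_geP[B0|[e]].
  exists (fun=> set0); split=> [_|_ i x|x] //; first exact: open0.
  by have [U BU] := cover x; have : set0 U by rewrite -B0.
have eP n : [set U | B U /\ independent U] (e n) by exact: funS.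
exists e; split=> [n|n|x]; [exact/oB/(eP n).1|exact: (eP n).2|].
have [U BU Ux] := cover x.
have [n _ enU] : (e @` setT) U by rewrite image_eq.
by exists n; rewrite enU.
Qed.

Theorem borel_maximal_independent :
  exists M, [/\ borel_set M, independent M &
                forall x, M x \/ exists2 i, W i & M (f i x)].
Proof.
have [V [oV iV coverV]] := independent_open_cover.
exists (\bigcup_n greedy V n); split.
- apply: borel_bigcup => // n _; apply: greedy_borel => m; exact: open_borel.
- move=> i x Wi [m _ xm] [n _ fxn].
  apply: (greedy_independent iV Wi (n := maxn m n)).
    exact: greedy_monotone (leq_maxl _ _) _ xm.
  exact: greedy_monotone (leq_maxr _ _) _ fxn.
- move=> x; have [n /greedy_maximal[Mx|[i Wi Mfx]]] := coverV x.
    by left; exists n.+1.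
  by right; exists i => //; exists n.
Qed.

End MaximalIndependentSet.

(** * The shift space and its free part *)

Lemma countable_seq (T : choiceType) :
  countable [set: T] -> countable [set: seq T].
Proof. by move=> /choicePcountable[T' ->]; exact: countableP. Qed.

Lemma second_countable_set_type (T : topologicalType) (A : set T) :
  @second_countable T -> @second_countable (set_type A).
Proof.
move=> [B cB [oB nB]]; exists [set set_val @^-1` b | b in B].
  exact: sub_countable (card_image_le _ _) cB.
split=> [_ [b /oB ob <-]|x U [_ [[V oV <-] Vx VU]]]; first by exists b.
have [b [Bb bx] bV] := nB (set_val x) V (open_nbhs_nbhs (conj oV Vx)).
by exists (set_val @^-1` b); [split=> //; exists b|move=> y /bV/VU].
Qed.

Lemma hausdorff_set_type (T : topologicalType) (A : set T) :
  hausdorff_space T -> hausdorff_space (set_type A).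
Proof.
move=> hT x y xy; apply: val_inj; apply: hT => U V Ux Vy.
have cval : continuous (@set_val _ A) by exact: initial_continuous.
have [z UVz] := xy _ _ (cval x U Ux) (cval y V Vy).
by exists (set_val z).
Qed.

Section ShiftSpace.
Variable G : groupType.
Implicit Types (g h : G) (s : seq G) (x y : shift_space G).
Implicit Types U : set (shift_space G).

Lemma shift_space_compact : compact [set: shift_space G].
Proof.
have := @tychonoff G (fun=> bool) (fun=> setT) (fun=> bool_compact).
by congr compact; apply/seteqP.
Qed.

Lemma shift_space_hausdorff : hausdorff_space (shift_space G).
Proof. by apply: hausdorff_product => _; exact: discrete_hausdorff. Qed.

Definition agree s x y := forall h, h \in s -> x h = y h.

Lemma open_agree s x : open (agree s x).
Proof.
elim: s => [|h s IH].
  by rewrite (_ : agree _ _ = setT); [exact: openT|apply/seteqP].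
rewrite (_ : agree _ _ = (fun y => y h) @^-1` [set x h] `&` agree s x).
  apply: openI => //; apply: open_comp; last exact: discrete_open.
  by move=> y _; exact: (@proj_continuous G (fun=> bool) h y).
apply/seteqP; split=> y; last first.
  by move=> [/= yh ys] f; rewrite inE => /orP[/eqP->|/ys].
by move=> ys; split=> [/=|f fs]; rewrite ys // ?mem_head// inE fs orbT.
Qed.

Lemma nbhs_agree x U : nbhs x U -> exists s, agree s x `<=` U.
Proof.
move=> Ux; pose F := filter_from [set: seq G] (fun s => agree s x).
have FF : Filter F.
  apply: filter_from_filter; first by exists [::].
  move=> s t _ _; exists (s ++ t) => // y xy.
  by split=> h hs; apply: xy; rewrite mem_cat hs ?orbT.
have cF : F --> x.
  apply/cvg_sup => h V [W [[B oB <-] Bx BV]].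
  exists [:: h] => // y xy; apply: BV => /=.
  by rewrite -(xy h) // mem_head.
by have [s _ sU] := cF U Ux; exists s.
Qed.

Lemma agree_dense U : (forall s x, exists2 y, agree s x y & U y) -> dense U.
Proof.
move=> dU O [x Ox] oO; have [s sO] := nbhs_agree (open_nbhs_nbhs (conj oO Ox)).
by have [y /sO Oy Uy] := dU s x; exists y.
Qed.

(* Every configuration agrees on a finite set with a finitely supported one. *)
Lemma shift_space_second_countable :
  countable [set: G] -> @second_countable (shift_space G).
Proof.
move=> cG; pose cyl (st : seq G * seq G) := agree st.1 (fun h => h \in st.2).
exists (range cyl).
  apply: (sub_countable (card_image_le _ _)); rewrite -setXTT.
  by apply: countableX; exact: countable_seq.
split=> [_ [st _ <-]|x U /nbhs_agree[s sU]]; first exact: open_agree.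
pose t := [seq h <- s | x h].
have tE h : h \in s -> (h \in t) = x h.
  by move=> hs; rewrite mem_filter hs andbT.
exists (cyl (s, t)); first by split=> [|h /tE]; first by exists (s, t).
by move=> y ty; apply: sU => h hs; rewrite -ty //= tE.
Qed.

Lemma shift_actM g h x : shift_act (g * h)%g x = shift_act g (shift_act h x).
Proof. by apply/funext => f; rewrite /shift_act invgM mulgA. Qed.

Lemma shift_act1 x : shift_act 1%g x = x.
Proof. by apply/funext => f; rewrite /shift_act invg1 mul1g. Qed.

Lemma shift_act_continuous g : continuous (@shift_act G g).
Proof.
move=> x U /nbhs_agree[s sU].
have /open_nbhs_nbhs : open_nbhs x (agree [seq (g^-1 * h)%g | h <- s] x).
  by split=> //; exact: open_agree.
by apply: filterS => y xy; apply: sU => h hs; apply: xy; exact: map_f.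
Qed.

Lemma shift_act_open g U : open U -> open (shift_act g @` U).
Proof.
move=> oU; rewrite (_ : _ @` U = shift_act g^-1%g @^-1` U).
  by apply: (continuousP _).1 => //; exact: shift_act_continuous.
apply/seteqP; split=> [_ [x Ux <-]|x Ux] /=.
  by rewrite -shift_actM mulVg shift_act1.
by exists (shift_act g^-1%g x); rewrite // -shift_actM mulgV shift_act1.
Qed.

Lemma residual_shift_act g P :
  residual P -> residual [set x : shift_space G | P (shift_act g x)].
Proof.
apply: residual_preimage; first exact: shift_act_continuous.
exact: shift_act_open.
Qed.

Definition moved_by g : set (shift_space G) :=
  [set x | exists h, x (g^-1 * h)%g <> x h].

Lemma moved_by_open g : open (moved_by g).
Proof.
rewrite openE => x [h xh].
have /open_nbhs_nbhs : open_nbhs x (agree [:: h; (g^-1 * h)%g] x).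
  by split=> //; exact: open_agree.
by apply: filterS => y xy; exists h; rewrite -!xy // !inE eqxx ?orbT.
Qed.

Lemma moved_by_dense g :
  infinite_set [set: G] -> g <> 1%g -> dense (moved_by g).
Proof.
move=> infG g1; apply: agree_dense => s x.
have [h hs] : exists h, h \notin s.
  apply: contrapT => /forallNP sG; apply: infG.
  by apply: sub_finite_set (finite_seq s) => h _ /=; have /negP/negPn := sG h.
exists (fun f => if f == h then ~~ x (g^-1 * h)%g else x f).
  by move=> f fs; case: eqP => // fh; rewrite -fh fs in hs.
exists h; rewrite eqxx; case: eqP => [|_]; last by case: (x _).
by move=> /(canRL (mulgK h)); rewrite mulgV => /eqP; rewrite invg_eq1 => /eqP.
Qed.

Lemma residual_free_part : countable [set: G] -> infinite_set [set: G] ->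
  residual (@free_part G).
Proof.
move=> cG infG.
have : residual (\bigcap_(g in [set g | g <> 1%g]) moved_by g).
  apply: residual_bigcap => [|g g1].
    exact: sub_countable (subset_card_le _) cG.
  apply: residual_open_dense; [exact: moved_by_open|exact: moved_by_dense].
by apply: residualS => x Mx g /Mx[h xh] /(congr1 (@^~ h)).
Qed.

Definition displacing (Q : set G) :=
  forall s, exists2 g, Q g & forall h, h \in s -> (g * h)%g \notin s.

Lemma displacing_infinite Q : displacing Q -> infinite_set [set: G].
Proof.
move=> dQ /finite_seqP[s sG].
have sE g : g \in s by have : [set: G] g by []; rewrite sG.
by have [g _ /(_ _ (sE 1%g))] := dQ s; rewrite sE.
Qed.

Lemma residual_shift_recurrent Q : countable [set: G] -> displacing Q ->
  residual [set x : shift_space G |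
    forall U, nbhs x U -> exists2 g, Q g & U (shift_act g x)].
Proof.
move=> cG dQ; apply: residual_recurrent.
- exact: shift_space_second_countable.
- exact: shift_act_continuous.
move=> U oU [x Ux]; have [s sU] := nbhs_agree (open_nbhs_nbhs (conj oU Ux)).
have [g Qg gs] := dQ s; exists g => //.
exists (fun f => if (g * f)%g \in s then x (g * f)%g else x f).
split; apply: sU => h hs; first by rewrite ifN // gs.
by rewrite /shift_act mulVKg hs.
Qed.

End ShiftSpace.

Section FreePart.
Variable G : groupType.
Notation X := (set_type (@free_part G)).
Implicit Types (g h : G) (x y : X).

Lemma free_part_shift g (x : shift_space G) :
  free_part x -> free_part (shift_act g x).
Proof.
move=> Fx h h1; rewrite -shift_actM => /(congr1 (shift_act g^-1%g)).
rewrite -!shift_actM mulVg shift_act1; apply: Fx.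
by rewrite -conjgE => /eqP; rewrite conjg_eq1 => /eqP.
Qed.

Definition free_shift g x : X :=
  SigSub (mem_set (@free_part_shift g _ (set_valP x))).

Lemma free_shiftM g h x :
  free_shift (g * h)%g x = free_shift g (free_shift h x).
Proof. by apply: val_inj => /=; rewrite shift_actM. Qed.

Lemma free_shift1 x : free_shift 1%g x = x.
Proof. by apply: val_inj => /=; rewrite shift_act1. Qed.

Lemma free_shiftK g : cancel (free_shift g) (free_shift g^-1%g).
Proof. by move=> x; rewrite -free_shiftM mulVg free_shift1. Qed.

Lemma free_shift_fixed g x : free_shift g x = x -> g = 1%g.
Proof.
move=> /(congr1 set_val) gx; apply: contrapT => g1.
exact: set_valP x g g1 gx.
Qed.

Lemma free_shift_continuous g : continuous (free_shift g).
Proof.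
have cval : continuous (@set_val _ (@free_part G)).
  exact: initial_continuous.
apply: continuous_comp_initial => x.
by apply: (continuous_comp (@cval x)); exact: shift_act_continuous.
Qed.

Lemma shift_graphP (S : set G) x y : ~ S 1%g ->
  shift_graph S x y <-> exists2 g, S g & y = free_shift g x.
Proof.
move=> S1; split=> [[_ [g Sg gx]]|[g Sg ->]].
  by exists g => //; apply: val_inj.
split; last by exists g.
by move=> xg; apply: S1; rewrite -(@free_shift_fixed g x).
Qed.

Section BorelColoring.
Variables (C : countType) (c : X -> C).
Hypothesis bc : forall i, borel_set (c @^-1` [set i]).
Hypothesis cG : countable [set: G].

Lemma borel_coloring_generically_open : exists U : C -> set (shift_space G),
  (forall i, open (U i)) /\
  residual [set x | forall g i z, set_val z = shift_act g x ->
    (c z = i <-> U i (shift_act g x))].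
Proof.
have /choice[U UP] i : exists U, open U /\ residual [set x |
    forall z, set_val z = x -> (c z = i <-> U x)].
  have [B /borel_baire_property[U oU BU] cB] := borel_set_type (bc i).
  exists U; split=> //; apply: residualS BU => x BUx z zx.
  by move: BUx; rewrite -zx /= -[B _]/((set_val @^-1` B) z) -cB.
exists U; split=> [i|]; first exact: (UP i).1.
have : residual (\bigcap_g \bigcap_i [set x | forall z,
    set_val z = shift_act g x -> (c z = i <-> U i (shift_act g x))]).
  apply: residual_bigcap => // g _.
  apply: residual_bigcap => [|i _]; first exact: countableP.
  exact: residual_shift_act (UP i).2.
by apply: residualS => x Ux g i; exact: Ux.
Qed.

Theorem borel_coloring_recurrent (Q : set G) : displacing Q ->
  exists z, forall (I : finType) (h : I -> G),
    exists2 g, Q g &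
      forall i, c (free_shift (h i * g)%g z) = c (free_shift (h i) z).
Proof.
move=> dQ; have [U [oU rU]] := borel_coloring_generically_open.
have rR := residual_shift_recurrent cG dQ.
have rF := residual_free_part cG (displacing_infinite dQ).
have [||x [_ [[xU xR] xF]]] := residual_dense (@shift_space_compact G)
  (@shift_space_hausdorff G) (residualI (residualI rU rR) rF) (O := setT).
- by exists (fun=> false).
- exact: openT.
pose z : X := SigSub (mem_set xF); exists z => I h.
have near_x : \forall y \near x, forall i,
    U (c (free_shift (h i) z)) (shift_act (h i) y).
  apply: (filter_forall (nbhs_filter x)) => i; apply: shift_act_continuous.
  apply: open_nbhs_nbhs; split; first exact: oU.
  exact/(xU _ _ (free_shift (h i) z)).
have [g Qg gU] := xR _ near_x.
by exists g => // i; apply/(xU (h i * g)%g) => //; rewrite shift_actM.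
Qed.

End BorelColoring.

End FreePart.

(** * Walks in a generated finite group *)

Definition is_walk (gT : finGroupType) (A : {set gT}) n x (w : nat -> gT) :=
  [/\ w 0%N = 1%g, w n = x &
      forall j, (j < n)%N -> exists2 a, a \in A & w j.+1 = (a * w j)%g].

(* Padding with the trivial step [1] makes every large length available. *)
Lemma generated_walk (gT : finGroupType) (A : {set gT}) : 1%g \in A ->
  exists N, forall n x, (N <= n)%N -> x \in <<A>>%g ->
  exists w, is_walk A n x w.
Proof.
move=> A1; have /choice[l lP] : forall x, exists l : seq gT,
    x \in <<A>>%g -> all [in A] l /\ (\prod_(a <- l) a = x)%g.
  move=> x; have [|_] := boolP (x \in <<A>>)%g; last by exists [::].
  case/gen_prodgP => n [c Ac ->]; exists (map c (index_enum 'I_n)) => _.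
  by rewrite big_map; split=> //; apply/allP => _ /mapP[i _ ->]; exact: Ac.
exists (\max_x size (l x)) => n x Nn /lP[lA lx].
have ln : (size (l x) <= n)%N by apply: leq_trans Nn; exact: leq_bigmax.
pose l' := nseq (n - size (l x)) 1%g ++ l x.
have sl' : size l' = n by rewrite size_cat size_nseq subnK.
have l'A : all [in A] l' by rewrite all_cat all_nseq A1 orbT.
exists (fun j => \prod_(a <- drop (n - j) l') a)%g; split.
- by rewrite subn0 drop_oversize ?sl' // big_nil.
- by rewrite subnn drop0 big_cat /= big_nseq iter_mulg_1 expg1n lx mul1g.
- move=> j jn; have jl' : (n - j.+1 < size l')%N by rewrite sl'; lia.
  exists (nth 1%g l' (n - j.+1)); first exact: (allP l'A) (mem_nth _ jl').
  by rewrite (drop_nth 1%g jl') big_cons subnSK.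
Qed.

(** * Colorings of consecutive layers *)

Section LayerColorings.
Variable k : nat.
Local Open Scope ring_scope.
Import GRing.Theory.
Implicit Types (a b d : 'Z_k).

Definition reflected (C : Type) (f g : 'Z_k -> C) :=
  exists d, forall a, g (d - a) = f a.

(* If [a] keeps its color at [- a], then [a + 1] cannot use [- a], and so keeps
   its color at [- (a + 1)]; going around the cycle, [d = 0] throughout. *)
Lemma layers_reflected (C : finType) (f g : 'Z_k -> C) :
  (#|C| <= #|'Z_k|)%N -> injective f -> injective g ->
  (forall a b, a + b <> 0 -> a + b <> 1 -> f a <> g b) -> reflected f g.
Proof.
move=> Ck fI gI fg.
have next_layer a : g (- a) = f a \/ g (1 - a) = f a.
  have /codomP[b gb] := inj_card_onto gI Ck (f a).
  have [ab0|/eqP ab0] := eqVneq (a + b) 0.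
    by left; rewrite gb -(addKr a b) ab0 addr0.
  have [ab1|/eqP ab1] := eqVneq (a + b) 1.
    by right; rewrite gb -(addKr a b) ab1 addrC.
  by case: (fg a b ab0 ab1).
have [[a ga]|nz] := pselect (exists a, g (- a) = f a); last first.
  by exists 1 => a; case: (next_layer a) => // ga; case: nz; exists a.
have {}ga n : g (- (a + n%:R)) = f (a + n%:R).
  elim: n => [|n IH]; first by rewrite addr0.
  case: (next_layer (a + n.+1%:R)) => //.
  rewrite (_ : 1 - (a + n.+1%:R) = - (a + n%:R)); last by rewrite -natr1; ring.
  rewrite IH => /fI/addrI; rewrite -natr1 => /eqP.
  by rewrite addrC -subr_eq subrr eq_sym oner_eq0.
exists 0 => b; rewrite sub0r.
by have := ga (val (b - a)); rewrite natr_Zp addrC subrK.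
Qed.

Lemma iterated_reflection (C : Type) (f : nat -> 'Z_k -> C) :
  (forall n, reflected (f n) (f n.+1)) ->
  forall n, exists d, forall a, f n (d + (-1) ^+ n * a) = f 0%N a.
Proof.
move=> f_reflected; elim=> [|n [d IH]].
  by exists 0 => a; rewrite mul1r add0r.
have [d' fS] := f_reflected n; exists (d' - d) => a; rewrite -IH -fS.
by congr (f _ _); rewrite exprS; ring.
Qed.

Lemma odd_reflections_neq (C : Type) (f : nat -> 'Z_k -> C) n : (2 < k)%N ->
  injective (f 0%N) -> (forall m, reflected (f m) (f m.+1)) ->
  odd n -> f n <> f 0%N.
Proof.
move=> k_gt2 fI /iterated_reflection/(_ n)[d fn] n_odd fn0.
have {fn} da a : d - a = a.
  by apply: fI; rewrite -[RHS]fn fn0 -signr_odd n_odd mulN1r.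
have d0 : d = 0 by rewrite -[d]subr0 da.
have /eqP := da 1; rewrite d0 sub0r eq_sym -subr_eq0 opprK.
move=> /eqP two0; have := val_Zp_nat (ltnW k_gt2) 2.
by rewrite -[2%:R]/(1 + 1) two0 modn_small.
Qed.

End LayerColorings.

(** * The shift graph of [Delta k] *)

Section DeltaShift.
Variable k : nat.
Local Open Scope ring_scope.
Import GRing.Theory.
Notation X := (set_type (@free_part (Delta k))).
Implicit Types (a b i : 'Z_k) (m n : int) (x y z : X).

Definition dshift a m : X -> X := free_shift ((a, m) : Delta k).

Lemma dshiftD a b m n x :
  dshift a m (dshift b n x) = dshift (a + (-1) ^ m * b) (m + n) x.
Proof. by rewrite /dshift -free_shiftM. Qed.

Lemma dshift0 x : dshift 0 0 x = x.
Proof. exact: free_shift1. Qed.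

Lemma Delta_gens_not1 : ~ @Delta_gens k 1%g.
Proof. by case=> -[]. Qed.

Lemma Delta_countable : countable [set: Delta k].
Proof. exact: (@countableP ('Z_k * int)%type). Qed.

Lemma Delta_coloringP C (c : X -> C) :
  proper_coloring (shift_graph (@Delta_gens k)) c <->
  (forall x i, i <> 0 -> c (dshift i 0 x) <> c x) /\
  (forall x i, i <> 0 -> i <> 1 -> c (dshift i 1 x) <> c x).
Proof.
have adjP x y := shift_graphP x y Delta_gens_not1.
split=> [cP|[c0 c1] x y /adjP[[i m] /= gi ->]].
  split=> [x i i0|x i i0 i1]; apply/nesym/cP/adjP.
    by exists ((i, 0) : Delta k); first by constructor 1.
  by exists ((i, 1) : Delta k); first by constructor 2.
case: gi => /= -[i0]; first by move=> ->; exact/nesym/c0.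
  by move=> i1 ->; exact/nesym/c1.
move=> i1 ->; have := c1 (dshift i (-1) x) i i0 i1.
by rewrite dshiftD expr1z mulN1r !subrr dshift0.
Qed.

Definition separated (N : nat) (M : set X) := forall x a m,
  `|m| <= N%:Z -> M x -> M (dshift a m x) -> a = 0 /\ m = 0.

Definition syndetic (N : nat) (M : set X) := forall x, exists a m,
  `|m| <= N%:Z /\ M (dshift a m x).

Definition odd_translations : set (Delta k) :=
  [set ((0, n%:Z) : Delta k) | n in [set n | odd n]].

Lemma odd_translations_displacing : displacing odd_translations.
Proof.
move=> s; pose B := \max_(h <- s) absz h.2.
exists ((0, B.*2.+1%:Z) : Delta k).
  by exists B.*2.+1; rewrite //= odd_double.
have sB h : h \in s -> (absz h.2 <= B)%N by move=> hs; exact: leq_bigmax_seq.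
move=> h /sB hB; apply/negP => /sB.
rewrite -[(_ * h)%g]/(Delta_mul _ h) /Delta_mul /=; lia.
Qed.

Theorem Delta_borel_colorable_gt (n : nat) : (2 < k)%N ->
  borel_colorable (shift_graph (@Delta_gens k)) n -> (k < n)%N.
Proof.
move=> k_gt2 [c [bc /Delta_coloringP[c0 c1]]]; rewrite ltnNge; apply/negP => nk.
have [z zrec] := borel_coloring_recurrent
  (fun j => bc [set j]) Delta_countable odd_translations_displacing.
pose f (m : nat) a := c (dshift a m%:Z z).
have fI (m : nat) : injective (f m).
  move=> a b; apply: contraPP => ab.
  have := c0 (dshift b m%:Z z) (a - b).
  rewrite dshiftD expr0z mul1r subrK add0r.
  by apply=> /eqP; rewrite subr_eq0 => /eqP.
have fS (m : nat) : reflected (f m) (f m.+1).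
  apply: layers_reflected => // [|a b ab0 ab1].
    by rewrite !card_ord Zp_cast // ltnW.
  have := c1 (dshift a m%:Z z) (a + b) ab0 ab1.
  by rewrite dshiftD expr1z mulN1r addrC addKr -intS => /nesym.
have [_ [m m_odd <-] zm] := zrec 'Z_k (fun a => (a, 0) : Delta k).
apply: (odd_reflections_neq k_gt2 (fI 0%N) fS m_odd); apply/funext => a.
rewrite /f -(zm a) free_shiftM -/(dshift 0 m%:Z z) -/(dshift a 0 _) dshiftD.
by rewrite mulr0 addr0 add0r.
Qed.

End DeltaShift.

(** * Recoloring between sparse markers *)

Section FirstEntry.
Variables (T A : Type) (P : nat -> A -> set T).

Definition first_entry n a : set T :=
  P n a `&` \bigcap_(i in `I_n) \bigcap_b ~` P i b.

Lemma first_entry_exists x :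
  (exists n a, P n a x) -> exists n a, first_entry n a x.
Proof.
move=> [n Pn]; have exP : exists n, `[< exists a, P n a x >].
  by exists n; exact/asboolP.
have [m /asboolP[a Pm] min_m] := ex_minnP exP; exists m, a; split=> //.
move=> i /= im b _ Pi; move: im; rewrite ltnNge min_m //.
by apply/asboolP; exists b.
Qed.

Lemma first_entry_uniq x m n a b :
  (forall i c d, P i c x -> P i d x -> c = d) ->
  first_entry m a x -> first_entry n b x -> (m, a) = (n, b).
Proof.
move=> Puniq [Pm minm] [Pn minn]; have [mn|nm|mn] := ltngtP m n.
- by case: (minn m mn a I).
- by case: (minm n nm b I).
- by move: Pn; rewrite -mn => /(Puniq _ _ _ Pm) ->.
Qed.

End FirstEntry.

Lemma first_entry_borel (T : topologicalType) (A : Type)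
    (P : nat -> A -> set T) n a :
  countable [set: A] -> (forall i b, borel_set (P i b)) ->
  borel_set (first_entry P n a).
Proof.
move=> cA bP; apply: borel_setI => //; apply: borel_bigcap => // i _.
by apply: borel_bigcap => // b _; exact: borel_setC.
Qed.

Section SparseMarkers.
Variables k N : nat.
Local Open Scope ring_scope.
Import GRing.Theory Num.Theory.

Definition punctured_window : set (Delta k) :=
  [set g : Delta k | `|g.2| <= N%:Z /\ g <> 1%g].

Lemma finite_punctured_window : finite_set punctured_window.
Proof.
pose p (q : 'Z_k * 'I_N.*2.+1) : Delta k := (q.1, q.2%:Z - N%:Z).
apply: sub_finite_set (finite_image p (@finite_finset _ setT)).
move=> -[a m] [/= mN _].
have mB : (absz (m + N%:Z)%R < N.*2.+1)%N by lia.
by exists (a, Ordinal mB) => //; congr (_, _); rewrite /=; lia.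
Qed.

Lemma punctured_windowV g : punctured_window g -> punctured_window g^-1%g.
Proof.
move=> [gN g1]; split; last by move=> /eqP; rewrite invg_eq1 => /eqP.
by rewrite -[g^-1%g]/(Delta_inv g) /= normrN.
Qed.

Lemma Delta_borel_markers : exists M : set (set_type (@free_part (Delta k))),
  [/\ borel_set M, separated N M & syndetic N M].
Proof.
have [||||M [bM iM mM]] := borel_maximal_independent finite_punctured_window
  (@free_shift_continuous (Delta k)).
- move=> g x /punctured_windowV Wg; exists g^-1%g => //; exact: free_shiftK.
- apply: second_countable_set_type; apply: shift_space_second_countable.
  exact: Delta_countable.
- apply: hausdorff_set_type; exact: shift_space_hausdorff.
- by move=> g x [_ g1] /free_shift_fixed.
exists M; split=> // [x a m mN Mx Mmx|x].
  apply: contrapT => am0; apply: (iM (a, m) x) => //; split=> // -[a0 m0].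
  by apply: am0.
have [Mx|[[a m] [mN _] Mm]] := mM x; last by exists a, m.
by exists 0, 0; rewrite dshift0 normr0.
Qed.

End SparseMarkers.

Section SignedTranslation.
Variable R : pzRingType.
Local Open Scope ring_scope.
Import GRing.Theory.
Implicit Types a b d : R.

Lemma signed_translation_inj n d : injective (fun a => d + (-1) ^+ n * a).
Proof. by move=> a b /addrI /(can_inj (signrMK n)). Qed.

Lemma sub_signr_fixed n b a : b - (-1) ^+ n * a = b -> a = 0.
Proof.
move=> ba; apply/oppr_inj/(@signed_translation_inj n b).
by rewrite mulrN ba oppr0 mulr0 addr0.
Qed.

End SignedTranslation.

Section Recoloring.
Variable k : nat.
Local Open Scope ring_scope.
Import GRing.Theory Num.Theory.
Notation X := (set_type (@free_part (Delta k))).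
Implicit Types (a b d : 'Z_k) (i j n : nat) (x y z : X).

(* A vertex [z] has offset [a] from [x] when [x = dshift a (- n) z] for some
   [n].  If [dshift d n x] is in the layer of [z], then [z] has offset
   [d + (-1) ^+ n * a] from it, and this is the position where the next marker
   reads the color of [z]; [None] stands for the unused color. *)
Definition closing_perm n d : {perm option 'Z_k} :=
  perm (inj_omap (@signed_translation_inj _ n d)).

Definition spare_moves : {set {perm option 'Z_k}} :=
  [set tperm None o | o : option 'Z_k].

Lemma recoloring_walks :
  exists N (w : nat -> 'Z_k -> nat -> {perm option 'Z_k}), forall n d,
  (N <= n)%N -> is_walk spare_moves n (closing_perm n d) (w n d).
Proof.
have [|N walks] := @generated_walk _ spare_moves.
  by apply/imsetP; exists None; rewrite ?tperm1.
have /choice[w wP] : forall nd : nat * 'Z_k, exists w, (N <= nd.1)%N ->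
    is_walk spare_moves nd.1 (closing_perm nd.1 nd.2) w.
  move=> [n d] /=; have [nN|Nn] := ltnP n N; first by exists (fun=> 1%g).
  have [|w w_walk] := walks n (closing_perm n d) Nn; last by exists w.
  by rewrite gen_tperm inE.
by exists N, (fun n d => w (n, d)) => n d; exact: wP (n, d).
Qed.

Variables (N : nat) (M : set X).
Hypothesis M_borel : borel_set M.
Hypotheses (M_separated : separated N M) (M_syndetic : syndetic N M).

Definition marker_before j b : set X := dshift b (- j%:Z) @^-1` M.

Definition marker_after n d : set X := dshift d n.+1%:Z @^-1` M.

(* The last marker in or before the layer of [z] is [x = dshift b (- j) z], and
   the next one is [dshift d n.+1 x]. *)
Definition segment (q : nat * 'Z_k * (nat * 'Z_k)) : set X :=
  first_entry marker_before q.1.1 q.1.2 `&`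
  dshift q.1.2 (- q.1.1%:Z) @^-1` first_entry marker_after q.2.1 q.2.2.

Lemma marker_layer_uniq x (m : int) a b :
  M (dshift a m x) -> M (dshift b m x) -> a = b.
Proof.
move=> Ma Mb; have := @M_separated (dshift a m x) (b - a) 0.
rewrite dshiftD expr0z mul1r subrK add0r normr0 => /(_ isT Ma Mb)[/eqP].
by rewrite subr_eq0 => /eqP.
Qed.

Lemma segment_exists z : exists q, segment q z.
Proof.
have after x : exists n d, first_entry marker_after n d x.
  apply: first_entry_exists.
  have [a [m [mN Mm]]] := M_syndetic (dshift 0 N.+1%:Z x).
  exists (absz (m + N%:Z)), a; rewrite /marker_after /=.
  move: Mm; rewrite dshiftD mulr0 addr0.
  by rewrite (_ : (absz (m + N%:Z)).+1%:Z = m + N.+1%:Z) //; lia.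
have [|j [b zj]] := @first_entry_exists _ _ marker_before z.
  have [a [m [mN Mm]]] := M_syndetic (dshift 0 (- N%:Z) z).
  exists (absz (m - N%:Z)), a; rewrite /marker_before /=.
  move: Mm; rewrite dshiftD mulr0 addr0.
  by rewrite (_ : - (absz (m - N%:Z))%:Z = m - N%:Z) //; lia.
by have [n [d nd]] := after (dshift b (- j%:Z) z); exists ((j, b), (n, d)).
Qed.

Lemma segment_uniq z q q' : segment q z -> segment q' z -> q = q'.
Proof.
case: q q' => [[j b] [n d]] [[j' b'] [n' d']] [/= zj zn] [/= zj' zn'].
have [jj' bb'] := first_entry_uniq (fun i => @marker_layer_uniq z _) zj zj'.
move: zn'; rewrite -jj' -bb' => zn'; congr (_, _).
exact: first_entry_uniq (fun i => @marker_layer_uniq _ i.+1) zn zn'.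
Qed.

Definition segment_of z := sval (cid (segment_exists z)).

Lemma segment_ofP z : segment (segment_of z) z.
Proof. by rewrite /segment_of; case: cid. Qed.

Lemma segment_borel q : borel_set (segment q).
Proof.
have cZ : countable [set: 'Z_k] by exact: countableP.
have bM b (m : int) : borel_set (dshift b m @^-1` M).
  by apply: borel_preimage => //; exact: free_shift_continuous.
apply: borel_setI; first by apply: first_entry_borel => // i b; exact: bM.
apply: borel_preimage; first exact: free_shift_continuous.
by apply: first_entry_borel => // i b; exact: bM.
Qed.

Lemma segment_leq j b n d z : segment ((j, b), (n, d)) z -> (j <= n)%N.
Proof.
move=> [[_ minj] [Mn _]]; rewrite leqNgt; apply/negP => nj.
move: Mn; rewrite /marker_after /= dshiftD.
rewrite (_ : n.+1%:Z - j%:Z = - (j - n.+1)%N%:Z); last by lia.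
by apply: (minj (j - n.+1)%N) => //=; lia.
Qed.

Lemma marker_gap x n d : M x -> marker_after n d x -> (N <= n)%N.
Proof.
move=> Mx Mn; rewrite leqNgt; apply/negP => nN.
by have [|] := M_separated _ Mx Mn; lia.
Qed.

Variable w : nat -> 'Z_k -> nat -> {perm option 'Z_k}.
Hypothesis w_walk : forall n d,
  (N <= n)%N -> is_walk spare_moves n (closing_perm n d) (w n d).

(* A vertex [j] layers after a marker and at offset [b] from it gets the color
   [w n.+1 d j (Some b)], where [dshift d n.+1] leads to the next marker. *)
Definition segment_color (q : nat * 'Z_k * (nat * 'Z_k)) : option 'Z_k :=
  w q.2.1.+1 q.2.2 q.1.1 (Some q.1.2).

Definition marker_color z := segment_color (segment_of z).

Lemma marker_colorE q z : segment q z -> marker_color z = segment_color q.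
Proof.
by move=> zq; rewrite /marker_color (segment_uniq (segment_ofP z) zq).
Qed.

Lemma marker_color_borel o : borel_set (marker_color @^-1` [set o]).
Proof.
rewrite (_ : _ @^-1` _ =
    \bigcup_(q in [set q | segment_color q = o]) segment q).
  by apply: borel_bigcup => // q _; exact: segment_borel.
apply/seteqP; split=> [z <-|z [q <- /marker_colorE]//].
by exists (segment_of z) => //; exact: segment_ofP.
Qed.

(* A marker determines the colors up to and including the layer of the next
   marker, where the two walks agree by the choice of [closing_perm]. *)
Lemma marker_color_until_next z j b n d : (j <= n.+1)%N ->
  M (dshift b (- j%:Z) z) ->
  first_entry marker_after n d (dshift b (- j%:Z) z) ->
  marker_color z = w n.+1 d j (Some b).
Proof.
rewrite leq_eqVlt ltnS => /predU1P[jE|jn] Mx xn; last first.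
  apply: (@marker_colorE ((j, b), (n, d))); split=> //; split=> // i /= ij b' _.
  have ijn : (j - i.+1 < n)%N by lia.
  have := xn.2 _ ijn (b' - (-1) ^ (j - i)%N%:Z * b) I.
  rewrite /marker_after /= dshiftD subnSK // subrK.
  by rewrite (_ : (j - i)%N%:Z - j%:Z = - i%:Z) //; lia.
have [_ w_end _] := w_walk d (leqW (marker_gap Mx xn.1)).
rewrite jE w_end permE /=.
have := xn.1; rewrite /marker_after /= dshiftD jE subrr -exprnP.
set b' := d + _ => Mz.
have [[[j' b0] [n' d']] zq] := segment_exists z.
have [[Mz' _] [zn' _]] := zq.
have [w0 _ _] := w_walk d' (leqW (marker_gap Mz' zn')).
have [j0 b0E] : (j', b0) = (0%N, b').
  apply: (first_entry_uniq (fun i => @marker_layer_uniq z _) zq.1).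
  by split=> [|i]; rewrite ?/marker_before /= ?oppr0.
by rewrite (marker_colorE zq) /segment_color /= j0 b0E w0 perm1.
Qed.

Lemma marker_color_dshift z j b n d l (i : 'Z_k) :
  segment ((j, b), (n, d)) z -> (j + l <= n.+1)%N ->
  marker_color (dshift i l%:Z z) =
    w n.+1 d (j + l)%N (Some (b - (-1) ^+ (j + l) * i)).
Proof.
move=> [[Mx _] xn] jln; set b' := b - _.
have xE : dshift b' (- (j + l)%N%:Z) (dshift i l%:Z z) = dshift b (- j%:Z) z.
  rewrite dshiftD -exprnN -exprVn invrN1 subrK.
  by congr (dshift _ _ _); rewrite PoszD opprD subrK.
by apply: marker_color_until_next => //; rewrite xE.
Qed.

Lemma marker_color_proper :
  proper_coloring (shift_graph (@Delta_gens k)) marker_color.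
Proof.
apply/Delta_coloringP; split=> z i i0.
  case: (segment_of z) (segment_ofP z) => -[j b] [n d] zq.
  rewrite (marker_colorE zq) (@marker_color_dshift _ _ _ _ _ 0%N i zq) addn0.
    by move=> /perm_inj[/sub_signr_fixed].
  exact: leq_trans (segment_leq zq) (leqnSn n).
case: (segment_of z) (segment_ofP z) => -[j b] [n d] zq _.
have jn : (j < n.+1)%N := segment_leq zq.
have Nn : (N <= n.+1)%N.
  by case: zq => -[Mx _] [xn _]; exact: leqW (marker_gap Mx xn).
rewrite (marker_colorE zq) (@marker_color_dshift _ _ _ _ _ 1%N i zq) addn1 //.
have [_ _ /(_ j jn)[_ /imsetP[v _ ->] ->]] := w_walk d Nn.
rewrite permM => /perm_inj; by case: tpermP => // _ _ [/sub_signr_fixed].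
Qed.

End Recoloring.

Theorem Delta_borel_colorable k : (1 < k)%N ->
  borel_colorable (shift_graph (@Delta_gens k)) k.+1.
Proof.
move=> k_gt1; have [N [w w_walk]] := recoloring_walks k.
have [M [M_borel M_separated M_syndetic]] := Delta_borel_markers k N.
apply: (borel_colorable_finType
  (marker_color_borel M_borel M_separated M_syndetic w)).
  exact: marker_color_proper.
by rewrite card_option card_ord Zp_cast.
Qed.

Theorem theorem5 (k : nat) (k_ge3 : (3 <= k)%N) :
  is_borel_chromatic_number (shift_graph (@Delta_gens k)) k.+1.
Proof.
split; first exact: Delta_borel_colorable (ltnW k_ge3).
by move=> m; exact: Delta_borel_colorable_gt k_ge3.
Qed.
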